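(* Let $\zeta\in\mathbb{C}$ be a primitive third root of unity, let $e_0,e_1,e_2,e_3$ be the standard basis of $\mathbb{C}^4$, and let $$S=\{\,[e_i-\zeta^a e_j]\;\mid\; i\in\{0,1\},\ j\in\{2,3\},\ a\in\mathbb{Z}/3\mathbb{Z}\,\}\subset\mathbb{P}^3_{\mathbb{C}}.$$ Then the number of lines spanned by $S$ is $$f_1(S)=58.$$
   Context: $[v]$ denotes the point of $\mathbb{P}^3_{\mathbb{C}}=\mathbb{P}(\mathbb{C}^4)$ represented by a nonzero vector $v\in\mathbb{C}^4$. For a finite set $S\subset\mathbb{P}^3_{\mathbb{C}}$, $f_1(S)$ denotes the number of distinct lines in $\mathbb{P}^3_{\mathbb{C}}$ spanned by pairs of distinct points of $S$. *)

(* Defs.v *)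
From HB Require Import structures.
From mathcomp Require Import all_boot all_order all_algebra.
From mathcomp Require Import finmap complex reals.

Set Implicit Arguments.
Unset Strict Implicit.
Unset Printing Implicit Defensive.

Import GRing.Theory.
Local Open Scope ring_scope.
Local Open Scope fset_scope.

(* A point of P(V) is a one-dimensional subspace of V. *)
Record projective_space (F : fieldType) (V : vectType F) := ProjPoint {
  proj_subspace :> {vspace V};
  _ : \dim proj_subspace == 1%N
}.

HB.instance Definition _ (F : fieldType) (V : vectType F) :=
  [isSub for @proj_subspace F V].
HB.instance Definition _ (F : fieldType) (V : vectType F) :=
  [Choice of projective_space V by <:].

Lemma dim_vline_eq1 (F : fieldType) (V : vectType F) (v : V) :
  v != 0 -> \dim <[v]>%VS == 1%N.
Proof. by rewrite dim_vline => ->. Qed.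

(* The point [v]. *)
Definition proj_point (F : fieldType) (V : vectType F) (v : V) (v_neq0 : v != 0)
    : projective_space V :=
  ProjPoint (dim_vline_eq1 v_neq0).

(* The line through two distinct points is identified with the sum of the two
   one-dimensional subspaces, a two-dimensional subspace of V. *)
Definition spanned_lines (F : fieldType) (V : vectType F)
    (S : {fset projective_space V}) : {fset {vspace V}} :=
  [fset (proj_subspace P + proj_subspace Q)%VS | P in S, Q in S & P != Q].

Definition f1 (F : fieldType) (V : vectType F)
    (S : {fset projective_space V}) : nat :=
  #|` spanned_lines S|.

Definition basis_vec (F : fieldType) (k : 'I_4) : 'rV[F]_4 := delta_mx 0 k.

(* For i, j in 'I_2, [lshift 2 i] ranges over {0, 1} and [rshift 2 j] over
   {2, 3}. *)
Definition config_vec (F : fieldType) (zeta : F) (i j : 'I_2) (a : 'Z_3)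
    : 'rV[F]_4 :=
  basis_vec F (lshift 2 i) - zeta ^+ a *: basis_vec F (rshift 2 j).

Lemma config_vec_neq0 (F : fieldType) (zeta : F) (i j : 'I_2) (a : 'Z_3) :
  config_vec zeta i j a != 0.
Proof.
apply/eqP => /matrixP /(_ 0 (lshift 2 i)) /eqP.
by rewrite !mxE !eqxx (eq_lrshift (m := 2)) mulr0 subr0 oner_eq0.
Qed.

(* The exponent of [zeta] is the representative of a in {0, 1, 2}; the choice
   is immaterial when zeta ^+ 3 = 1. *)
Definition config (F : fieldType) (zeta : F)
    : {fset projective_space 'rV[F]_4} :=
  [fset proj_point (config_vec_neq0 zeta x.1.1 x.1.2 x.2)
     | x : 'I_2 * 'I_2 * 'Z_3].

(* Main.v *)
(** Three points [e_i - z^a e_j] with the same pair [{i, j}] are collinear,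
    because they lie on the line through [e_i] and [e_j]; since the graph with
    edges [{i, j}] is bipartite, hence triangle-free, there is no other
    collinear triple.  Each line spanned by the configuration is determined by
    the set of points of the configuration on it, and these sets are now known
    explicitly, so that counting them is a computation. *)

Require Import Defs.
From mathcomp Require Import all_boot all_order all_algebra.
From mathcomp Require Import finmap complex reals.
From mathcomp Require Import ring.

Import GRing.Theory.
Local Open Scope ring_scope.

Lemma card_fset_seq (T : choiceType) (A : {fset T}) (s : seq T) :
  A =i s -> #|` A|%fset = size (undup s).
Proof.
move=> eAs; rewrite -card_fseq; congr #|` _|%fset.
by apply/fsetP => x; rewrite eAs inE.
Qed.

(** Allows lines to be replaced by their incidence rows before duplicates are discarded. *)
Lemma size_undup_map_in (T1 T2 : eqType) (f : T1 -> T2) (s : seq T1) :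
  {in s &, injective f} -> size (undup (map f s)) = size (undup s).
Proof.
move=> f_inj; rewrite -(size_map f (undup s)); apply/perm_size/uniq_perm.
- exact: undup_uniq.
- rewrite map_inj_in_uniq ?undup_uniq // => x y.
  by rewrite !mem_undup; apply: f_inj.
- by move=> y; rewrite mem_undup; apply: eq_mem_map => x; rewrite mem_undup.
Qed.

Definition config_index : Type := 'I_2 * 'I_2 * 'Z_3.

(* Combinatorial description of collinearity, valid only for [x != y]. *)
Definition on_line (x y z : config_index) : bool :=
  if x.1 == y.1 then z.1 == x.1 else (z == x) || (z == y).

(* An explicit list, because [enum] does not reduce under [vm_compute]. *)
Definition config_indices : seq config_index :=
  let o2 := [:: @Ordinal 2 0 isT; @Ordinal 2 1 isT] in
  let o3 := [:: @Ordinal 3 0 isT; @Ordinal 3 1 isT; @Ordinal 3 2 isT] in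
  [seq (ij, a) | ij <- [seq (i, j) | i <- o2, j <- o2], a <- o3].

Definition config_pairs : seq (config_index * config_index) :=
  [seq p <- [seq (x, y) | x <- config_indices, y <- config_indices]
     | p.1 != p.2].

Lemma mem_config_indices (x : config_index) : x \in config_indices.
Proof.
by case: x => [[[[|[|//]] ?] [[|[|//]] ?]] [[|[|[|//]]] ?]].
Qed.

Lemma mem_config_pairs (p : config_index * config_index) :
  (p \in config_pairs) = (p.1 != p.2).
Proof.
rewrite mem_filter; apply: andb_idr => _.
by case: p => x y; apply: (allpairs_f pair); apply: mem_config_indices.
Qed.

(** The 12 points give 66 unordered pairs; the 12 pairs inside the four collinear triples yield only
    4 lines, so there are 66 - 12 + 4 = 58 distinct rows. *)
Lemma count_on_line :
  size (undup [seq [seq on_line p.1 p.2 z | z <- config_indices]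
                 | p <- config_pairs]) = 58%N.
Proof. by vm_compute. Qed.

Section Configuration.

Variables (F : fieldType) (zeta : F).
Hypothesis zeta_prim : 3.-primitive_root zeta.

Definition index_vec (x : config_index) : 'rV[F]_4 :=
  config_vec zeta x.1.1 x.1.2 x.2.

Definition index_line (p : config_index * config_index) : {vspace 'rV[F]_4} :=
  (<[index_vec p.1]> + <[index_vec p.2]>)%VS.

Lemma index_vec_lshift x (k : 'I_2) :
  index_vec x 0 (lshift 2 k) = (k == x.1.1)%:R.
Proof.
by rewrite !mxE eqxx (eq_lshift (m := 2)) (eq_lrshift (m := 2)) mulr0 subr0.
Qed.

Lemma index_vec_rshift x (k : 'I_2) :
  index_vec x 0 (rshift 2 k) = - (zeta ^+ x.2 * (k == x.1.2)%:R).
Proof.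
by rewrite !mxE eqxx (@eq_rshift 2 2) (eq_rlshift (m := 2)) sub0r.
Qed.

Lemma expr_zeta_neq0 n : zeta ^+ n != 0.
Proof.
rewrite expf_neq0 //; apply/eqP => z0; have := prim_expr_order zeta_prim.
by rewrite z0 expr0n => /esym/eqP; rewrite oner_eq0.
Qed.

Lemma expr_zeta_inj (a b : 'Z_3) : zeta ^+ a = zeta ^+ b -> a = b.
Proof.
move/eqP; rewrite (eq_prim_root_expr zeta_prim).
by rewrite !modn_small ?ltn_ord // => /eqP/val_inj.
Qed.

(** The nonzero coordinate among the first two is 1 on both sides, which forces [k = 1]; the one
    among the last two then gives [j] and the power of [zeta], hence the exponent. *)
Lemma index_vec_scale_inj x y k : index_vec x = k *: index_vec y -> x = y.
Proof.
move=> exy.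
have eL i : (i == x.1.1)%:R = k * (i == y.1.1)%:R.
  by rewrite -!index_vec_lshift exy mxE.
have eR j : zeta ^+ x.2 * (j == x.1.2)%:R = k * (zeta ^+ y.2 * (j == y.1.2)%:R).
  by apply: oppr_inj; rewrite -(mulrN k) -!index_vec_rshift exy mxE.
have := eL x.1.1; rewrite eqxx; case: eqP => [ei|_]; last first.
  by move/eqP; rewrite mulr0 oner_eq0.
rewrite mulr1 => k1; have := eR x.1.2; rewrite eqxx -k1 mul1r mulr1.
case: eqP => [ej|_]; last by move/eqP; rewrite mulr0 (negPf (expr_zeta_neq0 _)).
rewrite mulr1 => /expr_zeta_inj ea.
by case: x y ei ej ea {exy eL eR} => [[? ?] ?] [[? ?] ?] /= -> -> ->.
Qed.

Lemma mem_index_line x y z : x != y ->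
  (index_vec z \in index_line (x, y)) = on_line x y z.
Proof.
move=> nxy; rewrite /on_line; apply/idP/idP.
  case/memv_addP => _ /vlineP[k ->] [_ /vlineP[l ->] /= ez].
  have eL i : (i == z.1.1)%:R = k * (i == x.1.1)%:R + l * (i == y.1.1)%:R.
    by rewrite -!index_vec_lshift ez !mxE.
  have eR j : zeta ^+ z.2 * (j == z.1.2)%:R
      = k * (zeta ^+ x.2 * (j == x.1.2)%:R) + l * (zeta ^+ y.2 * (j == y.1.2)%:R).
    by apply: oppr_inj; rewrite opprD -(mulrN k) -(mulrN l) -!index_vec_rshift ez !mxE.
  have zx : l = 0 -> (z == x) || (z == y).
    move=> l0; rewrite l0 scale0r addr0 in ez.
    by rewrite (index_vec_scale_inj _ _ _ ez) eqxx.
  have zy : k = 0 -> (z == x) || (z == y).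
    move=> k0; rewrite k0 scale0r add0r in ez.
    by rewrite (index_vec_scale_inj _ _ _ ez) eqxx orbT.
  (* [z.1.1] differs from [x.1.1] or from [y.1.1]; the coordinate at the missed index vanishes on
     [z], which kills the coefficient of that point. *)
  have [nI|/negPn/eqP eI] := boolP (x.1.1 != y.1.1).
    have -> : (x.1 == y.1) = false by apply: contraNF nI => /eqP ->.
    have [ezx|ezy] := boolP (z.1.1 == x.1.1).
      apply: zx; have := eL y.1.1.
      by rewrite (eqP ezx) eqxx eq_sym (negPf nI) mulr0 mulr1 add0r.
    apply: zy; have := eL x.1.1.
    by rewrite eqxx eq_sym (negPf ezy) (negPf nI) mulr0 mulr1 addr0.
  (* The same argument in the last two coordinates, up to a nonzero power of [zeta]. *)
  have [nJ|/negPn/eqP eJ] := boolP (x.1.2 != y.1.2).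
    have -> : (x.1 == y.1) = false by apply: contraNF nJ => /eqP ->.
    have [ezx|ezy] := boolP (z.1.2 == x.1.2).
      apply: zx; have := eR y.1.2.
      rewrite (eqP ezx) eqxx eq_sym (negPf nJ) !mulr0 mulr1 add0r => /esym/eqP.
      by rewrite mulf_eq0 (negPf (expr_zeta_neq0 _)) orbF => /eqP.
    apply: zy; have := eR x.1.2.
    rewrite eqxx eq_sym (negPf ezy) (negPf nJ) !mulr0 mulr1 addr0 => /esym/eqP.
    by rewrite mulf_eq0 (negPf (expr_zeta_neq0 _)) orbF => /eqP.
  (* Now the line lies in the span of [e_i] and [e_j], so the two nonzero coordinates of [z] must be
     at [i] and [j]. *)
  have -> : x.1 == y.1 by rewrite -pair_eqE /= eI eJ !eqxx.
  rewrite -pair_eqE /=; apply/andP; split; apply/negPn/negP => nz.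
    have := eL z.1.1; rewrite eqxx -eI (negPf nz) !mulr0 addr0.
    by move/eqP; rewrite oner_eq0.
  have := eR z.1.2; rewrite eqxx -eJ (negPf nz) !mulr0 addr0 mulr1.
  by move/eqP; rewrite (negPf (expr_zeta_neq0 _)).
case: eqP => [exy /eqP ezx|_ /orP[]/eqP->]; last 2 first.
- by rewrite (subvP (addvSl _ _)) ?memv_line.
- by rewrite (subvP (addvSr _ _)) ?memv_line.
have nc : zeta ^+ x.2 - zeta ^+ y.2 != 0.
  rewrite subr_eq0; apply: contra nxy => /eqP/expr_zeta_inj ea.
  by case: x y exy ea {ezx} => [? ?] [? ?] /= -> ->.
(* The coordinate at [i] makes the coefficients sum to 1; the one at [j] then determines [k]. *)
pose k := (zeta ^+ z.2 - zeta ^+ y.2) / (zeta ^+ x.2 - zeta ^+ y.2).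
have -> : index_vec z = k *: index_vec x + (1 - k) *: index_vec y.
  rewrite /index_vec /config_vec ezx exy; apply/rowP => m; rewrite !mxE /k.
  by field.
by apply: memv_add; rewrite memvZ ?memv_line.
Qed.

Lemma spanned_lines_config :
  spanned_lines (config zeta) =i [seq index_line p | p <- config_pairs].
Proof.
move=> L; apply/imfset2P/mapP => /=.
  case=> P /imfsetP[x _ ->] [Q /andP[/imfsetP[y _ ->] nPQ] ->].
  exists (x, y) => //; rewrite mem_config_pairs /=.
  by apply: contraNneq nPQ => ->.
case=> [[x y]]; rewrite mem_config_pairs /= => nxy ->.
exists (proj_point (config_vec_neq0 zeta x.1.1 x.1.2 x.2)).
  by apply/imfsetP; exists x.
exists (proj_point (config_vec_neq0 zeta y.1.1 y.1.2 y.2)) => //.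
rewrite inE /=; apply/andP; split; first by apply/imfsetP; exists y.
(* Distinct indices give distinct points: equal points would have proportional vectors. *)
apply: contra nxy => /eqP/(congr1 (@proj_subspace _ _)) /= exy.
have := memv_line (index_vec x); rewrite exy => /vlineP[k /index_vec_scale_inj ->].
exact: eqxx.
Qed.

Definition incidence (L : {vspace 'rV[F]_4}) : seq bool :=
  [seq index_vec z \in L | z <- config_indices].

(** The two generators of the line are themselves configuration points, so equal incidence rows put
    both of them in [L]. *)
Lemma incidence_sub (p : config_index * config_index) L :
  incidence (index_line p) = incidence L -> (index_line p <= L)%VS.
Proof.
move/eq_in_map => eL.
by rewrite subv_add -!memvE -!eL ?mem_config_indices //
  (subvP (addvSl _ _)) ?(subvP (addvSr _ _)) ?memv_line.
Qed.

Lemma f1_config : f1 (config zeta) = 58%N.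
Proof.
rewrite /f1 (card_fset_seq _ _ _ spanned_lines_config).
rewrite -(size_undup_map_in _ _ incidence); last first.
  (* Spanned lines with the same incidence row contain each other. *)
  move=> _ _ /mapP[p _ ->] /mapP[q _ ->] epq.
  by apply/eqP; rewrite eqEsubv !incidence_sub.
rewrite -map_comp -count_on_line; congr (size (undup _)).
apply/eq_in_map => -[x y]; rewrite mem_config_pairs /= => nxy.
by apply: eq_map => z; apply: mem_index_line.
Qed.

End Configuration.

(* MathComp; the complex numbers are R[i] over R : realType. *)
Theorem lemma5p2 (R : realType) (zeta : R[i])
    (zeta_prim : 3.-primitive_root zeta) :
  f1 (config zeta) = 58%N.
Proof. exact: f1_config. Qed.
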